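(* Let $(a_n)_{n\ge 1}$ be a sequence of quaternions with $|a_n|<1$ for all $n\ge 1$, and suppose that all $a_n$ lie on the same slice, i.e. there exists $I\in\mathbb{S}$ such that for every $n\ge 1$, $a_n=r_ne^{\theta_n I}=r_n(\cos\theta_n+I\sin\theta_n)$ with $r_n=|a_n|<1$ and $\theta_n\in\mathbb{R}$. Then the slice regular Malmquist–Takenaka system $(\mathbf{\Phi}_n)_{n\ge 1}$ generated by $(a_n)_{n\ge 1}$ is a slice regular orthonormal system in $H^2(\mathbb{B})$; that is, each $\mathbf{\Phi}_n$ is a slice regular function belonging to $H^2(\mathbb{B})$, and $\langle \mathbf{\Phi}_n,\mathbf{\Phi}_m\rangle=\delta_{nm}$ for all $n,m\ge 1$.
   Context: $\mathbb{H}$ is the skew field of quaternions with norm $|q|=\sqrt{q\overline q}$, $\mathbb{B}=\{q\in\mathbb{H}:|q|<1\}$, and $\mathbb{S}=\{q\in\mathbb{H}:q^2=-1\}$ is the sphere of imaginary units. For $I\in\mathbb{S}$, $L_I=\mathbb{R}+\mathbb{R}I$ and $\mathbb{B}_I=\mathbb{B}\cap L_I$. Slice regular functions: a function $f:\mathbb{B}\to\mathbb{H}$ is (slice) regular if for every $I\in\mathbb{S}$ its restriction $f_I$ to $\mathbb{B}_I$ has continuous partial derivatives and satisfies $\frac12\left(\frac{\partial}{\partial x}+I\frac{\partial}{\partial y}\right)f_I(x+yI)=0$; equivalently, $f(q)=\sum_{n\ge 0}q^na_n$ is a power series with coefficients $a_n\in\mathbb{H}$ converging on $\mathbb{B}$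 (similarly on larger balls centered at $0$). For regular $f(q)=\sum q^na_n$, $g(q)=\sum q^nb_n$: - regular product: $(f\ast g)(q)=\sum_{n\ge 0}q^n\sum_{k=0}^na_kb_{n-k}$ (associative, generally non-commutative); - regular conjugate: $f^c(q)=\sum_{n\ge 0}q^n\overline{a_n}$; symmetrization: $f^s=f\ast f^c=f^c\ast f$; - regular reciprocal: $f^{-\ast}=(f^s)^{-1}f^c$ (where $f^s\neq 0$). For $a\in\mathbb{B}$ the regular Blaschke function is $\mathcal{B}_a(q)=(1-q\overline a)^{-\ast}\ast(q-a)$. Hardy space: $H^2(\mathbb{B})$ is the space of regular $f:\mathbb{B}\to\mathbb{H}$, $f(q)=\sum_{n\ge0}q^na_n$, with $\sum_{n\ge 0}|a_n|^2<\infty$, with inner product, for $g(q)=\sum_{n\ge 0} q^nb_n$, $$\langle f,g\rangle=\sum_{n\ge 0}\overline{b_n}a_n=\lim_{r\to1^-}\frac1{2\pi}\int_0^{2\pi}\overline{g(re^{I\theta})}f(re^{I\theta})\,d\theta\quad\text{for any } I\in\mathbb{S}.$$ Slice regular Malmquist–Takenaka system generated by a sequence $(a_n)_{n\ge1}$ in $\mathbb{B}$: $$\mathbf{\Phi}_1(z)=\sqrt{1-|a_1|^2}\,(1-z\overline{a_1})^{-\ast},$$ $$\mathbf{\Phi}_n(z)=\sqrt{1-|a_n|^2}\,\bigl(\mathcal{B}_{a_1}\ast\mathcal{B}_{a_2}\ast\cdots\ast\mathcal{B}_{a_{n-1}}\bigr)(z)\ast(1-z\overline{a_n})^{-\ast}\quad(n\ge2).$$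 *)

(* Defs.v *)
From HB Require Import structures.
From mathcomp Require Import all_boot all_order all_algebra.
From mathcomp Require Import ring lra.
From mathcomp Require Import all_classical all_reals all_analysis.

Set Implicit Arguments.
Unset Strict Implicit.
Unset Printing Implicit Defensive.

Import Order.TTheory GRing.Theory Num.Theory.
Import numFieldNormedType.Exports.

Local Open Scope classical_set_scope.
Local Open Scope ring_scope.

(* [Quat t x y z] stands for t + x i + y j + z k. *)
Record quat (R : Type) := Quat { qre : R; qi : R; qj : R; qk : R }.

Lemma quat_ext (R : Type) (p q : quat R) :
  qre p = qre q -> qi p = qi q -> qj p = qj q -> qk p = qk q -> p = q.
Proof. by case: p => ????; case: q => ???? /= -> -> -> ->. Qed.

HB.instance Definition _ (R : Type) := gen_eqMixin (quat R).
HB.instance Definition _ (R : Type) := gen_choiceMixin (quat R).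

Section QuaternionAlgebra.
Variable R : realType.
Implicit Types p q r : quat R.

Definition qadd p q :=
  Quat (qre p + qre q) (qi p + qi q) (qj p + qj q) (qk p + qk q).

Definition qopp p := Quat (- qre p) (- qi p) (- qj p) (- qk p).

Definition qscale (c : R) p := Quat (c * qre p) (c * qi p) (c * qj p) (c * qk p).

Definition qmul p q := Quat
  (qre p * qre q - qi p * qi q - qj p * qj q - qk p * qk q)
  (qre p * qi q + qi p * qre q + qj p * qk q - qk p * qj q)
  (qre p * qj q - qi p * qk q + qj p * qre q + qk p * qi q)
  (qre p * qk q + qi p * qj q - qj p * qi q + qk p * qre q).

Definition qconj p := Quat (qre p) (- qi p) (- qj p) (- qk p).

Definition qnormsq p := qre p ^+ 2 + qi p ^+ 2 + qj p ^+ 2 + qk p ^+ 2.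

Definition qnorm p : R := Num.sqrt (qnormsq p).

Definition qinv p := qscale (qnormsq p)^-1 (qconj p).

Let zero : quat R := Quat 0 0 0 0.
Let one : quat R := Quat 1 0 0 0.

Fact qaddA : associative qadd.
Proof. by move=> p q r; apply: quat_ext => /=; ring. Qed.
Fact qaddC : commutative qadd.
Proof. by move=> p q; apply: quat_ext => /=; ring. Qed.
Fact qadd0 : left_id zero qadd.
Proof. by move=> p; apply: quat_ext => /=; ring. Qed.
Fact qaddN : left_inverse zero qopp qadd.
Proof. by move=> p; apply: quat_ext => /=; ring. Qed.

HB.instance Definition _ :=
  GRing.isZmodule.Build (quat R) qaddA qaddC qadd0 qaddN.

Fact qmulA : associative qmul.
Proof. by move=> p q r; apply: quat_ext => /=; ring. Qed.
Fact qmul1 : left_id one qmul.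
Proof. by move=> p; apply: quat_ext => /=; ring. Qed.
Fact qmulr1 : right_id one qmul.
Proof. by move=> p; apply: quat_ext => /=; ring. Qed.
Fact qmulDl : left_distributive qmul +%R.
Proof. by move=> p q r; apply: quat_ext => /=; ring. Qed.
Fact qmulDr : right_distributive qmul +%R.
Proof. by move=> p q r; apply: quat_ext => /=; ring. Qed.
Fact qone_neq0 : one != 0.
Proof. by apply/eqP => -[/eqP]; rewrite oner_eq0. Qed.

HB.instance Definition _ := GRing.Zmodule_isNzRing.Build (quat R)
  qmulA qmul1 qmulr1 qmulDl qmulDr qone_neq0.

Fact qscaleA (a b : R) p : qscale a (qscale b p) = qscale (a * b) p.
Proof. by apply: quat_ext => /=; ring. Qed.
Fact qscale1 : left_id 1 qscale.
Proof. by move=> p; apply: quat_ext => /=; ring. Qed.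
Fact qscaleDr : right_distributive qscale +%R.
Proof. by move=> a p q; apply: quat_ext => /=; ring. Qed.
Fact qscaleDl p : {morph qscale^~ p : a b / a + b}.
Proof. by move=> a b; apply: quat_ext => /=; ring. Qed.

HB.instance Definition _ := GRing.Zmodule_isLmodule.Build R (quat R)
  qscaleA qscale1 qscaleDr qscaleDl.

Fact qscaleAl (a : R) p q : a *: (p * q) = (a *: p) * q.
Proof. by apply: quat_ext => /=; ring. Qed.

HB.instance Definition _ :=
  GRing.Lmodule_isLalgebra.Build R (quat R) qscaleAl.

Fact qscaleAr (a : R) p q : a *: (p * q) = p * (a *: q).
Proof. by apply: quat_ext => /=; ring. Qed.

HB.instance Definition _ :=
  GRing.Lalgebra_isAlgebra.Build R (quat R) qscaleAr.

Lemma qnormsq_ge0 p : 0 <= qnormsq p.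
Proof. by rewrite /qnormsq !addr_ge0 ?sqr_ge0. Qed.

Lemma qnormsq_eq0 p : (qnormsq p == 0) = (p == 0).
Proof.
apply/eqP/eqP => [|->]; last by rewrite /qnormsq /= !expr0n /= !addr0.
rewrite /qnormsq => /eqP.
rewrite !paddr_eq0 ?addr_ge0 ?sqr_ge0// !sqrf_eq0.
by move=> /andP[/andP[/andP[/eqP h1 /eqP h2] /eqP h3] /eqP h4]; apply: quat_ext.
Qed.

Fact qmulVr : {in [pred p | p != 0], left_inverse 1 qinv *%R}.
Proof.
move=> p; rewrite inE -qnormsq_eq0 => p0.
by apply: quat_ext; rewrite /= /qnormsq in p0 *; field.
Qed.
Fact qmulrV : {in [pred p | p != 0], right_inverse 1 qinv *%R}.
Proof.
move=> p; rewrite inE -qnormsq_eq0 => p0.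
by apply: quat_ext; rewrite /= /qnormsq in p0 *; field.
Qed.
Fact qunitP p q : q * p = 1 /\ p * q = 1 -> [pred p | p != 0] p.
Proof.
move=> [+ _] /=; apply: contraPneq => ->; rewrite mulr0 => /esym/eqP.
exact/negP/oner_neq0.
Qed.
Fact qinv_out : {in [predC [pred p | p != 0]], qinv =1 id}.
Proof.
move=> p; rewrite !inE negbK => /eqP ->.
by apply: quat_ext => /=; rewrite ?oppr0 mulr0.
Qed.

HB.instance Definition _ := GRing.NzRing_hasMulInverse.Build (quat R)
  qmulVr qmulrV qunitP qinv_out.

Fact qnormD p q : qnorm (p + q) <= qnorm p + qnorm q.
Proof.
rewrite -(@ler_pXn2r _ 2) ?nnegrE ?addr_ge0 ?sqrtr_ge0//.
rewrite sqrrD !sqr_sqrtr ?qnormsq_ge0//.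
pose d := qre p * qre q + qi p * qi q + qj p * qj q + qk p * qk q.
have -> : qnormsq (p + q) = qnormsq p + d *+ 2 + qnormsq q.
  by rewrite /qnormsq /d /=; ring.
rewrite lerD2r lerD2l lerMn2r /=.
rewrite (le_trans (ler_norm d))// -(@ler_pXn2r _ 2) ?nnegrE ?mulr_ge0 ?sqrtr_ge0//.
rewrite exprMn !sqr_sqrtr ?qnormsq_ge0// real_normK ?num_real// -subr_ge0.
(* Lagrange's identity *)
have -> : qnormsq p * qnormsq q - d ^+ 2 =
    (qre p * qi q - qi p * qre q) ^+ 2 + (qre p * qj q - qj p * qre q) ^+ 2 +
    (qre p * qk q - qk p * qre q) ^+ 2 + (qi p * qj q - qj p * qi q) ^+ 2 +
    (qi p * qk q - qk p * qi q) ^+ 2 + (qj p * qk q - qk p * qj q) ^+ 2.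
  by rewrite /qnormsq /d; ring.
by rewrite !addr_ge0 ?sqr_ge0.
Qed.

Fact qnormZ (c : R) p : qnorm (c *: p) = `|c| * qnorm p.
Proof.
rewrite /qnorm -sqrtr_sqr -sqrtrM ?sqr_ge0//; congr Num.sqrt.
by rewrite /qnormsq /=; ring.
Qed.

Fact qnorm0_eq0 p : qnorm p = 0 -> p = 0.
Proof.
move=> /eqP; rewrite sqrtr_eq0 => p0; apply/eqP; rewrite -qnormsq_eq0.
by rewrite eq_le p0 qnormsq_ge0.
Qed.

HB.instance Definition _ :=
  Lmodule_isNormed.Build R (quat R) qnormD qnormZ qnorm0_eq0.

Lemma qnormE p : `|p| = qnorm p. Proof. by []. Qed.

Lemma mulr_qconj p : p * qconj p = (`|p| ^+ 2)%:A.
Proof.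
rewrite qnormE sqr_sqrtr ?qnormsq_ge0//.
by apply: quat_ext; rewrite /qnormsq /=; ring.
Qed.

Lemma qnorm_def p : `|p| = Num.sqrt (qre (p * qconj p)).
Proof. by rewrite mulr_qconj /= mulr1 sqrtr_sqr normr_id. Qed.

End QuaternionAlgebra.

Section SliceRegular.
Variable R : realType.
Notation H := (quat R).
Implicit Types (f g : H -> H) (a b : nat -> H) (q : H).

Definition qball : set H := [set q | `|q| < 1].

Definition imag_unit : set H := [set I | I ^+ 2 = - 1].

Definition slice_point (I : H) (x y : R) : H := x%:A + y *: I.

Definition slice_dx f (I : H) (p : R * R) : H :=
  derive1 (fun x => f (slice_point I x p.2)) p.1.

Definition slice_dy f (I : H) (p : R * R) : H :=
  derive1 (fun y => f (slice_point I p.1 y)) p.2.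

(* Functions on the ball are total functions [H -> H]; only their values on
   [qball] matter. *)
Definition slice_regular f : Prop :=
  forall I, imag_unit I -> forall p : R * R, qball (slice_point I p.1 p.2) ->
  [/\ derivable (fun x => f (slice_point I x p.2)) p.1 1,
      derivable (fun y => f (slice_point I p.1 y)) p.2 1,
      {for p, continuous (slice_dx f I)},
      {for p, continuous (slice_dy f I)} &
      2^-1 *: (slice_dx f I p + I * slice_dy f I p) = 0].

Definition pseries_term a q : nat -> H := fun n => q ^+ n * a n.

Definition has_expansion f a : Prop :=
  forall q, qball q -> series (pseries_term a q) @ \oo --> f q.

Definition pseries_fun a : H -> H := fun q => lim (series (pseries_term a q) @ \oo).

(* The coefficients of the (unique) power series expansion of [f] on the ball,
   and the zero sequence if there is none. *)
Definition coef f : nat -> H := xget (fun=> 0) [set a | has_expansion f a].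

Definition star f g : H -> H :=
  pseries_fun (fun n => \sum_(k < n.+1) coef f k * coef g (n - k)%N).

Definition rconj f : H -> H := pseries_fun (fun n => qconj (coef f n)).

Definition symm f : H -> H := star f (rconj f).

Definition rinv f : H -> H := fun q => (symm f q)^-1 * rconj f q.

(* q |-> (1 - q \bar{c})^{-*} *)
Definition cauchy_kernel (c : H) : H -> H := rinv (fun q => 1 - q * qconj c).

Definition blaschke (c : H) : H -> H := star (cauchy_kernel c) (fun q => q - c).

Definition hardy2 f : Prop :=
  slice_regular f /\
  exists2 a, has_expansion f a & cvgn (series (fun n => `|a n| ^+ 2)).

Definition hardy_inner f g : H :=
  lim (series (fun n => qconj (coef g n) * coef f n) @ \oo).

(* [blaschke_prod a k] is B_{a 1} * ... * B_{a k.+1}. *)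
Fixpoint blaschke_prod a (k : nat) : H -> H :=
  if k is k'.+1 then star (blaschke_prod a k') (blaschke (a k.+1))
  else blaschke (a 1%N).

(* Sequences are indexed from 1: [a 0] is never used, and [malmquist a 0] is a
   dummy value. *)
Definition malmquist a (n : nat) : H -> H := fun q =>
  match n with
  | 0 => 0
  | 1 => Num.sqrt (1 - `|a 1%N| ^+ 2) *: cauchy_kernel (a 1%N) q
  | k.+2 => Num.sqrt (1 - `|a n| ^+ 2) *:
              star (blaschke_prod a k) (cauchy_kernel (a n)) q
  end.

End SliceRegular.

(* Main.v *)
Require Import Defs.
From HB Require Import structures.
From mathcomp Require Import all_boot all_order all_algebra.
From mathcomp Require Import ring lra.
From mathcomp Require Import all_classical all_reals all_analysis.
Import Order.TTheory GRing.Theory Num.Theory.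
Import numFieldNormedType.Exports.
Local Open Scope classical_set_scope.
Local Open Scope ring_scope.

(** The system is orthonormal because left regular multiplication by a Blaschke
function is an isometry of the Hardy space, as in the complex case, and
everything can be read off power series coefficients.

A regular function on the ball is a power series, determined by its
coefficients ([expansion_unique]); the regular product is the convolution of
coefficients. All sequences met here are absolutely summable, a class stable
under convolution ([l1_conv]), so no convergence question survives. The kernel
[(1 - q * qconj c)^{-*}] has the geometric coefficients [qconj c ^+ n]
([cauchy_kernel_expansion]), and [B_c] is its product with [q - c]. Since the
coefficients of both factors commute, [B_c * f = (q - c) * g] with
[g = (1 - q * qconj c)^{-*} * f], while [f = (1 - q * qconj c) * g]. Comparing
[|(q - c) g|^2] with [|(1 - q * qconj c) g|^2] coefficient by coefficient, the
difference telescopes and leaves one boundary term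
([blaschke_partial_sums]), which tends to 0: hence the isometry
([coef_inner_blaschke]). The same factorization makes [B_c * f] orthogonal to
the kernel at [c]: pairing with it is evaluation at [c], where [B_c] vanishes
([coef_inner_blaschke_kernel]); again a telescoping sum.

For [l < k], the functions numbered [l.+1] and [k.+1] both start with the
factors [B_{a 1} * ... * B_{a l}]. The isometry strips them, leaving
[B_{a l.+1} * u] against the kernel at [a l.+1], which gives 0. For [l = k]
what remains is the squared norm of a kernel, the geometric series
[1 / (1 - |c|^2)], compensated by the normalizing square roots.

Regularity holds for every convergent power series
([expansion_slice_regular]): on a slice, the increment commutes with the
variable, so powers obey the usual second-order Taylor bound ([expr_taylor]),
and the derivatives along [1] and [I] are [f'] and [I * f']. *)

(** * Norm, conjugation and limits of quaternions *)

Section QuaternionNorm.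
Set Implicit Arguments.
Unset Strict Implicit.
Variable R : realType.
Notation H := (quat R).
Implicit Types (p q l : H) (u : nat -> H).

Lemma qnormM p q : `|p * q| = `|p| * `|q|.
Proof.
rewrite !qnormE /qnorm -sqrtrM ?qnormsq_ge0//; congr Num.sqrt.
by rewrite /qnormsq /=; ring.
Qed.

Lemma qnorm1 : `|1 : H| = 1.
Proof. by rewrite qnormE /qnorm /qnormsq /= expr1n !expr0n /= !addr0 sqrtr1. Qed.

Lemma qnormX q n : `|q ^+ n| = `|q| ^+ n.
Proof. by elim: n => [|n IH]; rewrite ?expr0 ?qnorm1// !exprS qnormM IH. Qed.

Lemma qnorm_conj q : `|qconj q| = `|q|.
Proof. by rewrite !qnormE /qnorm /qnormsq /= !sqrrN. Qed.

Lemma qnormsqE q : qnormsq q = `|q| ^+ 2.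
Proof. by rewrite qnormE sqr_sqrtr ?qnormsq_ge0. Qed.

Lemma qconjM p q : qconj (p * q) = qconj q * qconj p.
Proof. by apply: quat_ext => /=; ring. Qed.

Lemma qconjK q : qconj (qconj q) = q.
Proof. by apply: quat_ext => /=; ring. Qed.

Lemma qconjD p q : qconj (p + q) = qconj p + qconj q.
Proof. by apply: quat_ext => /=; ring. Qed.

Lemma qconjB p q : qconj (p - q) = qconj p - qconj q.
Proof. by apply: quat_ext => /=; ring. Qed.

Lemma qconjZ (s : R) p : qconj (s *: p) = s *: qconj p.
Proof. by apply: quat_ext => /=; ring. Qed.

Lemma qconj0 : qconj 0 = 0 :> H.
Proof. by apply: quat_ext => /=; ring. Qed.

Lemma qconj1 : qconj 1 = 1 :> H.
Proof. by apply: quat_ext => /=; ring. Qed.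

Lemma qconjX q n : qconj (q ^+ n) = qconj q ^+ n.
Proof.
by elim: n => [|n IH]; rewrite ?expr0 ?qconj1// exprS exprSr qconjM IH.
Qed.

Lemma qconj_sum I (r : seq I) (F : I -> H) :
  qconj (\sum_(i <- r) F i) = \sum_(i <- r) qconj (F i).
Proof. by apply: (big_morph (@qconj R)); [exact: qconjD|exact: qconj0]. Qed.

Lemma sqr_le_qnorm q (x y : R) :
  y ^+ 2 = qnormsq q -> x ^+ 2 <= y ^+ 2 -> `|x| <= `|q|.
Proof.
move=> -> xq; rewrite qnormE /qnorm -(sqrtr_sqr x).
by rewrite ler_sqrt ?qnormsq_ge0.
Qed.

Lemma qcoord_le q :
  [/\ `|qre q| <= `|q|, `|qi q| <= `|q|, `|qj q| <= `|q| & `|qk q| <= `|q|].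
Proof.
by split; apply: (@sqr_le_qnorm q _ `|q|); rewrite -?qnormsqE// /qnormsq;
  have := (sqr_ge0 (qre q), sqr_ge0 (qi q), sqr_ge0 (qj q), sqr_ge0 (qk q));
  case=> [[[]]]; lra.
Qed.

Lemma qdecomp q :
  q = qre q *: Quat 1 0 0 0 + qi q *: Quat 0 1 0 0 +
      qj q *: Quat 0 0 1 0 + qk q *: Quat 0 0 0 1.
Proof. by apply: quat_ext => /=; ring. Qed.

(** Absolute convergence passes to the four coordinates, where it gives
convergence of real series. *)
Lemma cvgn_bounded_norm_sums u (M : R) :
  (forall N, \sum_(n < N) `|u n| <= M) -> cvgn (series u).
Proof.
move=> uM.
have coord (c : H -> R) : (forall p q, c (p + q) = c p + c q) -> c 0 = 0 ->
    (forall q, `|c q| <= `|q|) -> cvgn (fun N => c (series u N)).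
  move=> cD c0 cle.
  have -> : (fun N => c (series u N)) = series (fun n => c (u n)).
    by apply/funext => N; rewrite /series /=; exact: (big_morph c).
  apply: normed_cvg; apply: nondecreasing_is_cvgn.
    by apply/nondecreasing_series => n _ _; exact: normr_ge0.
  exists M => _ [N _ <-]; rewrite /normed_series_of seriesEord /=.
  by apply: le_trans (uM N); apply: ler_sum => i _; exact: cle.
have cle := qcoord_le.
have -> : series u = (fun N =>
   qre (series u N) *: Quat 1 0 0 0 + qi (series u N) *: Quat 0 1 0 0 +
   qj (series u N) *: Quat 0 0 1 0 + qk (series u N) *: Quat 0 0 0 1 : H).
  by apply/funext => N; rewrite -qdecomp.
by do ?apply: is_cvgD; apply: is_cvgZr_tmp; apply: coord => // q; have [] := cle q.
Qed.

Lemma cvg_norm_le u l (M : R) :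
  u @ \oo --> l -> (forall n, `|u n| <= M) -> `|l| <= M.
Proof.
move=> ul uM.
have h : (fun n => `|u n|) @ \oo --> `|l| by exact: cvg_norm.
rewrite -(cvg_lim _ h)//; apply: limr_le; first exact: (cvgP _ h).
by near=> n.
Unshelve. all: by end_near. Qed.

Section Limits.
Variables (T : Type) (F : set_system T).
Context {FF : Filter F}.
Implicit Types w : T -> H.

Lemma eq_fun_cvg (w1 w2 : T -> H) l : w1 =1 w2 -> w1 @ F --> l -> w2 @ F --> l.
Proof. by move=> /funext ->. Qed.

(** Stated for an abstract filter, so that it applies to neighbourhoods of a
quaternion as well as to sequences. *)
Lemma cvg_norm_dominated w l (e : T -> R) (C : R) :
  (\forall t \near F, `|w t - l| <= C * e t) -> e @ F --> (0 : R) -> w @ F --> l.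
Proof.
move=> we e0; apply/subr_cvg0/norm_cvg0P.
have h : (fun t => C * e t) @ F --> (0 : R).
  by rewrite -(mulr0 C); exact: cvgMl_tmp.
apply: squeeze_cvgr (@cvg_cst _ (0 : R) _ _ _) h.
by near=> t; rewrite normr_ge0 /=; near: t.
Unshelve. all: by end_near. Qed.

Lemma cvg_norm_sub w l : w @ F --> l -> `|w t - l| @[t --> F] --> (0 : R).
Proof. by move=> wl; apply/norm_cvg0P; exact/subr_cvg0. Qed.

Lemma cvg_lipschitz (f : H -> H) (C : R) w l :
  (forall p q, `|f p - f q| <= C * `|p - q|) ->
  w @ F --> l -> (fun t => f (w t)) @ F --> f l.
Proof.
move=> fC wl; apply: (@cvg_norm_dominated _ _ (fun t => `|w t - l|) C).
  by near=> t; exact: fC.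
exact: cvg_norm_sub.
Unshelve. all: by end_near. Qed.

Lemma cvg_qmulr w l q : w @ F --> l -> (fun t => w t * q) @ F --> l * q.
Proof.
by apply: (@cvg_lipschitz ( *%R^~ q) `|q|) => x y; rewrite -mulrBl qnormM mulrC.
Qed.

Lemma cvg_qmull w l q : w @ F --> l -> (fun t => q * w t) @ F --> q * l.
Proof.
by apply: (@cvg_lipschitz ( *%R q) `|q|) => x y; rewrite -mulrBr qnormM.
Qed.

Lemma cvg_qconj w l : w @ F --> l -> (fun t => qconj (w t)) @ F --> qconj l.
Proof.
by apply: (@cvg_lipschitz (@qconj R) 1) => x y; rewrite -qconjB qnorm_conj mul1r.
Qed.

End Limits.

End QuaternionNorm.

(** * Sequences of subexponential growth and Taylor bounds for powers *)

Section PowerSeries.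
Set Implicit Arguments.
Unset Strict Implicit.
Variable R : realType.
Notation H := (quat R).
Implicit Types (f g : H -> H) (a b : nat -> H) (x y q : H) (u : nat -> R).

(** These are the coefficient sequences of the power series converging on the
unit ball; the class absorbs polynomial factors, as differentiation needs. *)
Definition subexponential u :=
  forall r : R, 0 < r < 1 -> exists M, forall n, `|u n| * r ^+ n <= M.

Lemma geometric_sum_le (x : R) N : 0 <= x < 1 -> \sum_(n < N) x ^+ n <= (1 - x)^-1.
Proof.
move=> /andP[x0 x1]; rewrite -[leRHS]mul1r ler_pdivlMr ?subr_gt0//.
have -> : (\sum_(n < N) x ^+ n) * (1 - x) = 1 - x ^+ N.
  by have := subrX1 x N; lra.
by rewrite gerBl exprn_ge0.
Qed.

Lemma natmul_expr_bounded (x : R) : 0 < x < 1 -> exists C, forall n, n%:R * x ^+ n <= C.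
Proof.
move=> /andP[x0 x1]; exists ((1 - x)^-1) => n.
have x01 : 0 <= x < 1 by rewrite ltW.
(* each of the n powers below x ^+ n dominates it *)
apply: le_trans (geometric_sum_le n x01).
rewrite mulr_natl -[X in _ *+ X]card_ord -sumr_const; apply: ler_sum => k _.
by apply: ler_wiXn2l; [exact: ltW|exact: ltW|exact: ltnW].
Qed.

(** A slightly larger radius [s] pays for the factor [n]. *)
Lemma subexponential_natmul u : subexponential u -> subexponential (fun n => n%:R * u n).
Proof.
move=> us r /andP[r0 r1].
pose s := (r + 1) / 2.
have s0 : 0 < s by rewrite /s; lra.
have s1 : s < 1 by rewrite /s; lra.
have rs : 0 < r / s < 1.
  by rewrite divr_gt0//= ltr_pdivrMr// mul1r /s; lra.
have [|M uM] := us s; first by rewrite s0.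
have [C xC] := natmul_expr_bounded rs.
exists (C * M) => n.
have -> : `|n%:R * u n| * r ^+ n = (n%:R * (r / s) ^+ n) * (`|u n| * s ^+ n).
  rewrite normrM normr_nat exprMn exprVn.
  by field; rewrite expf_neq0// gt_eqF.
case/andP: rs => rs0 _; apply: ler_pM => //.
  by apply: mulr_ge0 => //; apply: exprn_ge0; exact: ltW.
by apply: mulr_ge0 => //; apply: exprn_ge0; exact: ltW.
Qed.

Lemma subexponential_shift u : subexponential u -> subexponential (fun n => u n.+1).
Proof.
move=> us r r01; have [M uM] := us r r01; exists (M / r) => n.
case/andP: r01 => r0 _.
by rewrite ler_pdivlMr// -mulrA -exprSr.
Qed.

Lemma subexponential_sum u r : subexponential u -> 0 < r < 1 ->
  exists M, forall N, \sum_(n < N) `|u n| * r ^+ n <= M.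
Proof.
move=> us /andP[r0 r1].
pose s := (r + 1) / 2.
have s0 : 0 < s by rewrite /s; lra.
have s1 : s < 1 by rewrite /s; lra.
have rs : 0 < r / s < 1.
  by rewrite divr_gt0//= ltr_pdivrMr// mul1r /s; lra.
have [|M uM] := us s; first by rewrite s0.
exists (M * (1 - r / s)^-1) => N.
have M0 : 0 <= M by apply: le_trans (uM 0%N); rewrite expr0 mulr1.
have rs' : 0 <= r / s < 1 by case/andP: rs => /ltW -> ->.
apply: le_trans (ler_wpM2l M0 (geometric_sum_le N rs')).
rewrite mulr_sumr; apply: ler_sum => n _.
have -> : `|u n| * r ^+ n = (`|u n| * s ^+ n) * (r / s) ^+ n.
  by rewrite -mulrA -exprMn mulrC (mulrC s) divfK ?gt_eqF// mulrC.
by apply: ler_wpM2r => //; apply: exprn_ge0; case/andP: rs'.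
Qed.

Lemma has_expansion_subexponential f a :
  has_expansion f a -> subexponential (fun n => `|a n|).
Proof.
move=> fa r /andP[r0 r1].
have nr : `|r%:A : H| = r by rewrite normrZ qnorm1 mulr1 gtr0_norm.
have /fa /cvgP /cvg_series_cvg_0 /cvgP /cvg_seq_bounded [M [_ bM]] : qball (r%:A : H).
  by rewrite /qball /= nr.
exists (M + 1) => n; rewrite normr_id.
have := bM (M + 1); rewrite ltrDl ltr01 => /(_ isT n I).
by rewrite /pseries_term /= qnormM qnormX nr mulrC.
Qed.

(** The factor [r] on the left stands for the exponent [n.-1] on the right,
which keeps the case [n = 0] uniform; likewise [r ^+ 2] in [expr_taylor]. *)
Lemma expr_lipschitz x y (r : R) n : 0 < r -> `|x| <= r -> `|y| <= r ->
  `|x ^+ n - y ^+ n| * r <= n%:R * r ^+ n * `|x - y|.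
Proof.
move=> r0 xr yr; elim: n => [|n IH]; first by rewrite !expr0 subrr normr0 !mul0r.
have -> : x ^+ n.+1 - y ^+ n.+1 = x * (x ^+ n - y ^+ n) + (x - y) * y ^+ n.
  by rewrite mulrBr mulrBl -!exprS addrA subrK.
have yn : `|y ^+ n| <= r ^+ n by rewrite qnormX lerXn2r ?nnegrE // ltW.
apply: (@le_trans _ _ ((r * `|x ^+ n - y ^+ n| + `|x - y| * r ^+ n) * r)).
  rewrite ler_pM2r//.
  apply: (le_trans (ler_normD _ _)).
  by rewrite !qnormM lerD// ?ler_wpM2r// ?ler_wpM2l.
rewrite mulrDl -mulrA -(natr1 n) exprS.
have := ler_wpM2l (ltW r0) IH; lra.
Qed.

(** Commutation lets all increments be moved to the left; the remainders
[E n] then satisfy [E n.+1 = x * E n + n * (x - y) ^+ 2 * y ^+ n.-1]. *)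
Lemma expr_taylor x y (r : R) n :
  GRing.comm x y -> 0 < r -> `|x| <= r -> `|y| <= r ->
  `|x ^+ n - y ^+ n - (x - y) * y ^+ n.-1 *+ n| * r ^+ 2 <=
  n%:R ^+ 2 * r ^+ n * `|x - y| ^+ 2.
Proof.
move=> cxy r0 xr yr; elim: n => [|n IH].
  by rewrite !expr0 subrr mulr0n subrr normr0 expr0n /= !mul0r.
pose h := x - y.
have chy : GRing.comm h y by apply/commr_sym/commrB => //; apply: commr_sym.
have -> : x ^+ n.+1 - y ^+ n.+1 - (x - y) * y ^+ n.+1.-1 *+ n.+1 =
   x * (x ^+ n - y ^+ n - (x - y) * y ^+ n.-1 *+ n) + h * (h * y ^+ n.-1) *+ n.
  rewrite -/h [n.+1.-1]/=.
  have -> : x ^+ n.+1 - y ^+ n.+1 = x * (x ^+ n - y ^+ n) + h * y ^+ n.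
    by rewrite mulrBr mulrBl -!exprS addrA subrK.
  have xE : x = h + y by rewrite subrK.
  case: n {IH} => [|n].
    by rewrite !expr0 !mulr0n mulr1n subr0 !subrr !mulr0 add0r addr0 subrr.
  rewrite [n.+1.-1]/= [RHS]/=.
  have xh : x * (h * y ^+ n) = h * (h * y ^+ n) + h * y ^+ n.+1.
    by rewrite {1}xE mulrDl [y * _]mulrA -chy -mulrA -exprS.
  rewrite [in RHS]mulrBr [x * (_ *+ _)]mulrnAr xh mulrnDl [in LHS]mulrS !opprD !addrA.
  by rewrite addrK [in RHS]addrAC subrK.
have nn : `|x * (x ^+ n - y ^+ n - (x - y) * y ^+ n.-1 *+ n)| * r ^+ 2 <=
    r * (n%:R ^+ 2 * r ^+ n * `|x - y| ^+ 2).
  by rewrite qnormM -mulrA ler_pM// mulr_ge0// exprn_ge0// ltW.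
have hh : `|h * (h * y ^+ n.-1) *+ n| * r ^+ 2 <= n%:R * r ^+ n.+1 * `|x - y| ^+ 2.
  rewrite normrMn !qnormM qnormX; case: n {IH nn} => [|n]; first by rewrite mulr0n !mul0r.
  rewrite [n.+1.-1]/=.
  have yn : `|y| ^+ n <= r ^+ n by rewrite lerXn2r ?nnegrE // ltW.
  have -> : n.+1%:R * r ^+ n.+2 * `|x - y| ^+ 2 =
      n.+1%:R * (`|h| ^+ 2 * (r ^+ n * r ^+ 2)).
    by rewrite -/h -exprD addn2; ring.
  have -> : `|h| * (`|h| * `|y| ^+ n) *+ n.+1 * r ^+ 2 =
      n.+1%:R * (`|h| ^+ 2 * (`|y| ^+ n * r ^+ 2)) by ring.
  apply: ler_wpM2l => //; apply: ler_wpM2l; first exact: exprn_ge0.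
  by apply: ler_wpM2r => //; apply: exprn_ge0; exact: ltW.
apply: (@le_trans _ _ (r * (n%:R ^+ 2 * r ^+ n * `|x - y| ^+ 2) +
   n%:R * r ^+ n.+1 * `|x - y| ^+ 2)).
  apply: le_trans (lerD nn hh); rewrite -mulrDl ler_wpM2r ?ler_normD//.
  by rewrite exprn_ge0 ?ltW.
rewrite -(natr1 n) (exprS r) -subr_ge0.
have -> : (n%:R + 1) ^+ 2 * (r * r ^+ n) * `|x - y| ^+ 2 -
  (r * (n%:R ^+ 2 * r ^+ n * `|x - y| ^+ 2) + n%:R * (r * r ^+ n) * `|x - y| ^+ 2)
  = (n%:R + 1) * r * r ^+ n * `|x - y| ^+ 2 by ring.
have r0' := ltW r0.
by rewrite !mulr_ge0 ?exprn_ge0 ?addr_ge0.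
Qed.

End PowerSeries.

(** * Slice regularity of power series *)

Section Regularity.
Set Implicit Arguments.
Unset Strict Implicit.
Variable R : realType.
Notation H := (quat R).
Implicit Types (f g : H -> H) (a b : nat -> H) (x y q v : H) (r : R).

Definition deriv_coef a : nat -> H := fun n => a n.+1 *+ n.+1.

Lemma subexponential_deriv a : subexponential (fun n => `|a n|) ->
  subexponential (fun n => `|deriv_coef a n|).
Proof.
move=> /subexponential_natmul /subexponential_shift.
by under [in X in X -> _]eq_fun do rewrite mulr_natl -normrMn.
Qed.

Lemma subexponential_expansion a :
  subexponential (fun n => `|a n|) -> has_expansion (pseries_fun a) a.
Proof.
move=> sa q; rewrite /qball /= => q1; rewrite /pseries_fun.
pose r := (1 + `|q|) / 2.
have q0 := normr_ge0 q.
have r0 : 0 < r by rewrite /r; lra.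
have r1 : r < 1 by rewrite /r; lra.
have qr : `|q| <= r by rewrite /r; lra.
have [|M aM] := subexponential_sum sa (r := r); first by rewrite r0.
suff : cvgn (series (pseries_term a q)) by [].
apply: (@cvgn_bounded_norm_sums _ _ M) => N; apply: le_trans (aM N).
apply: ler_sum => n _; rewrite /pseries_term qnormM qnormX mulrC normr_id.
by apply: ler_wpM2l => //; apply: lerXn2r => //; rewrite nnegrE ltW.
Qed.

(** The bound holds for the partial sums, uniformly in their length, hence for
their limit. *)
Lemma expansion_lipschitz f a r : has_expansion f a -> 0 < r < 1 ->
  exists C, forall x y, `|x| <= r -> `|y| <= r -> `|f x - f y| <= C * `|x - y|.
Proof.
move=> fa r01; case/andP: (r01) => r0 r1.
have /subexponential_natmul /subexponential_sum /(_ r01) [M aM] :=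
  has_expansion_subexponential fa.
exists (M / r) => x y xr yr.
have fx := fa x (le_lt_trans xr r1); have fy := fa y (le_lt_trans yr r1).
apply: cvg_norm_le (cvgB fx fy) _ => N /=.
rewrite !fctE !seriesEord /= -sumrB mulrAC ler_pdivlMr//.
apply: le_trans (ler_wpM2r (normr_ge0 _) (aM N)).
apply: le_trans (ler_wpM2r (ltW r0) (ler_norm_sum _ _ _)) _.
rewrite !mulr_suml; apply: ler_sum => n _.
rewrite /pseries_term -mulrBl qnormM mulrAC normrM normr_nat normr_id.
have -> : n%:R * `|a n| * r ^+ n * `|x - y| = n%:R * r ^+ n * `|x - y| * `|a n| by ring.
by apply: ler_wpM2r => //; exact: expr_lipschitz.
Qed.

Lemma expansion_taylor f g a r : has_expansion f a ->
  has_expansion g (deriv_coef a) -> 0 < r < 1 ->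
  exists C, forall x y, GRing.comm x y -> `|x| <= r -> `|y| <= r ->
    `|f x - f y - (x - y) * g y| <= C * `|x - y| ^+ 2.
Proof.
move=> fa ga r01; case/andP: (r01) => r0 r1.
have /subexponential_natmul /subexponential_natmul := has_expansion_subexponential fa.
move=> /subexponential_sum /(_ r01) [M aM].
exists (M / r ^+ 2) => x y cxy xr yr.
have x1 := le_lt_trans xr r1; have y1 := le_lt_trans yr r1.
(* the derived series is one term shorter, so partial sums are shifted *)
have shift z : `|z| < 1 -> (fun N => series (pseries_term a z) N.+1) @ \oo --> f z.
  by move=> z1; rewrite (cvg_shiftS (series (pseries_term a z))); exact: fa.
have gy : (fun N => (x - y) * series (pseries_term (deriv_coef a) y) N) @ \oo -->
  (x - y) * g y by apply: cvg_qmull; exact: ga.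
apply: cvg_norm_le (cvgB (cvgB (shift x x1) (shift y y1)) gy) _ => N /=.
rewrite !fctE !seriesEord /= -sumrB mulr_sumr.
rewrite (_ : _ - _ = \sum_(n < N.+1)
  (x ^+ n - y ^+ n - (x - y) * y ^+ n.-1 *+ n) * a n); last first.
  rewrite !big_ord_recl /= /pseries_term !expr0 !subrr mul0r !add0r.
  rewrite -sumrB; apply: eq_bigr => n _.
  rewrite /deriv_coef /bump /= add1n [in RHS]mulrBl.
  congr (_ - _); first by rewrite mulrBl.
  by rewrite add0n mulrnAl !mulrnAr mulrA.
rewrite mulrAC ler_pdivlMr ?exprn_gt0//.
apply: le_trans (ler_wpM2r (exprn_ge0 _ (normr_ge0 _)) (aM N.+1)).
apply: le_trans (ler_wpM2r (exprn_ge0 _ (ltW r0)) (ler_norm_sum _ _ _)) _.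
rewrite !mulr_suml; apply: ler_sum => n _.
rewrite qnormM mulrAC !normrM normr_nat normr_id.
have -> : n%:R * (n%:R * `|a n|) * r ^+ n * `|x - y| ^+ 2 =
  n%:R ^+ 2 * r ^+ n * `|x - y| ^+ 2 * `|a n| by ring.
by apply: ler_wpM2r => //; exact: expr_taylor.
Qed.

Lemma expansion_continuous f a q : has_expansion f a -> qball q ->
  {for q, continuous f}.
Proof.
move=> fa; rewrite /qball /= => q1.
pose r := (1 + `|q|) / 2.
have q0 := normr_ge0 q.
have r0 : 0 < r by rewrite /r; lra.
have r1 : r < 1 by rewrite /r; lra.
have qr : `|q| < r by rewrite /r; lra.
have [|C fC] := expansion_lipschitz fa (r := r); first by rewrite r0.
have n0 : `|x - q| @[x --> q] --> (0 : R).
  by apply: (@cvg_norm_sub _ _ (nbhs q) _ id q); exact: cvg_id.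
apply: (@cvg_norm_dominated _ _ (nbhs q) _ f (f q) (fun x => `|x - q|) C) n0.
near=> x; apply: fC; last exact: ltW.
apply: ltW; near: x; apply: (@cvgr_lt _ _ _ _ (fun x => `|x|) `|q|) => //.
exact: cvg_norm.
Unshelve. all: by end_near. Qed.

(** Along a direction commuting with the base point the powers differentiate
as in the complex plane, hence so does the series. *)
Lemma expansion_derivative f a q v : has_expansion f a -> qball q -> GRing.comm v q ->
  h^-1 *: (f (h *: v + q) - f q) @[h --> (0 : R)^'] -->
  v * pseries_fun (deriv_coef a) q.
Proof.
move=> fa; rewrite /qball /= => q1 cvq.
have := subexponential_deriv (has_expansion_subexponential fa).
move=> /subexponential_expansion ga.
pose r := (1 + `|q|) / 2.
have q0 := normr_ge0 q.
have r0 : 0 < r by rewrite /r; lra.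
have r1 : r < 1 by rewrite /r; lra.
have qr : `|q| < r by rewrite /r; lra.
have [|C fC] := expansion_taylor fa ga (r := r); first by rewrite r0.
have n0 : `|h| @[h --> (0 : R)^'] --> (0 : R).
  have /cvg_norm : h @[h --> (0 : R)^'] --> (0 : R) by exact: cvg_within.
  by rewrite normr0.
apply: (@cvg_norm_dominated _ _ _ _ _ _ (fun h : R => `|h|) (C * `|v| ^+ 2) _ n0).
near=> h.
have h0 : h != 0 by near: h; exact: nbhs_dnbhs_neq.
have hv : `|h| * `|v| <= r - `|q|.
  apply: ltW; near: h.
  apply: (@cvgr_lt _ _ _ _ (fun h : R => `|h| * `|v|) 0); last by rewrite subr_gt0.
  suff : `|h| * `|v| @[h --> (0 : R)^'] --> 0 * `|v| by rewrite mul0r.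
  exact: cvgMr_tmp n0.
have hvq : `|h *: v + q| <= r.
  by apply: le_trans (ler_normD _ _) _; rewrite normrZ -lerBrDr.
have chv : GRing.comm (h *: v + q) q.
  rewrite /GRing.comm mulrDl mulrDr; congr (_ + _).
  by rewrite -scalerAl -scalerAr cvq.
have := fC _ _ chv hvq (ltW qr); rewrite addrK => fCh.
have -> : h^-1 *: (f (h *: v + q) - f q) - v * pseries_fun (deriv_coef a) q =
   h^-1 *: (f (h *: v + q) - f q - (h *: v) * pseries_fun (deriv_coef a) q).
  by rewrite [in RHS]scalerBr -scalerAl scalerA mulVf// scale1r.
rewrite normrZ normfV mulrC ler_pdivrMr ?normr_gt0//.
by apply: le_trans fCh _; rewrite normrZ le_eqVlt; apply/orP; left; apply/eqP; ring.
Unshelve. all: by end_near. Qed.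

(** The two partial derivatives are [f'] and [I * f'], so the Cauchy-Riemann
combination vanishes because [I ^+ 2 = -1]. *)
Lemma expansion_slice_regular f a : has_expansion f a -> slice_regular f.
Proof.
move=> fa I; rewrite /imag_unit /= => I2.
have := subexponential_deriv (has_expansion_subexponential fa).
move=> /subexponential_expansion ga.
set g := pseries_fun (deriv_coef a) in ga.
have dx (p : R * R) : qball (slice_point I p.1 p.2) ->
    h^-1 *: (f (slice_point I (h + p.1) p.2) - f (slice_point I p.1 p.2))
      @[h --> (0 : R)^'] --> g (slice_point I p.1 p.2).
  move=> pb; have := expansion_derivative fa pb (commr_sym (commr1 _)).
  rewrite mul1r; under eq_fun do rewrite /slice_point addrA -scalerDl.
  by [].
have dy (p : R * R) : qball (slice_point I p.1 p.2) ->
    h^-1 *: (f (slice_point I p.1 (h + p.2)) - f (slice_point I p.1 p.2))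
      @[h --> (0 : R)^'] --> I * g (slice_point I p.1 p.2).
  move=> pb; have cI : GRing.comm I (slice_point I p.1 p.2).
    rewrite /slice_point /GRing.comm mulrDl mulrDr.
    by rewrite -!scalerAr -!scalerAl mul1r mulr1.
  have := expansion_derivative fa pb cI.
  under eq_fun do rewrite /slice_point addrCA -scalerDl.
  by [].
have dxE (p : R * R) : qball (slice_point I p.1 p.2) ->
    slice_dx f I p = g (slice_point I p.1 p.2).
  by move=> pb; rewrite /slice_dx /derive1; apply: cvg_lim => //; exact: dx.
have dyE (p : R * R) : qball (slice_point I p.1 p.2) ->
    slice_dy f I p = I * g (slice_point I p.1 p.2).
  by move=> pb; rewrite /slice_dy /derive1; apply: cvg_lim => //; exact: dy.
move=> p pb.
have spc : slice_point I z.1 z.2 @[z --> p] --> slice_point I p.1 p.2.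
  by apply: cvgD; apply: cvgZr_tmp; [exact: cvg_fst|exact: cvg_snd].
have nb : \forall z \near p, qball (slice_point I z.1 z.2).
  exact: (cvgr_lt _ (cvg_norm spc) _ pb).
have gc : g (slice_point I z.1 z.2) @[z --> p] --> g (slice_point I p.1 p.2).
  by apply: (cvg_comp _ _ spc); exact: expansion_continuous ga pb.
split.
- apply/cvg_ex; exists (g (slice_point I p.1 p.2)); have := dx _ pb.
  by under [in X in _ -> X]eq_fun do rewrite /= /GRing.scale /= mulr1.
- apply/cvg_ex; exists (I * g (slice_point I p.1 p.2)); have := dy _ pb.
  by under [in X in _ -> X]eq_fun do rewrite /= /GRing.scale /= mulr1.
- rewrite /prop_for /continuous_at dxE//; apply: cvg_trans gc; apply: near_eq_cvg.
  by near=> z; rewrite dxE//; near: z.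
- rewrite /prop_for /continuous_at dyE//.
  have Igc : I * g (slice_point I z.1 z.2) @[z --> p] --> I * g (slice_point I p.1 p.2).
    exact: cvg_qmull gc.
  apply: cvg_trans Igc; apply: near_eq_cvg.
  by near=> z; rewrite dyE//; near: z.
- by rewrite dxE// dyE// mulrA -expr2 I2 mulN1r subrr scaler0.
Unshelve. all: by end_near. Qed.

End Regularity.

(** * Uniqueness of expansions *)

Section Uniqueness.
Set Implicit Arguments.
Unset Strict Implicit.
Variable R : realType.
Notation H := (quat R).
Implicit Types (f g : H -> H) (a b d : nat -> H) (x q : H).

Lemma series_finite (u : nat -> H) N :
  (forall n, (N <= n)%N -> u n = 0) -> series u @ \oo --> \sum_(n < N) u n.
Proof.
move=> u0; rewrite -(cvg_shiftn N).
suff -> : (fun n => series u (n + N)%N) = fun=> \sum_(n < N) u n by exact: cvg_cst.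
apply/funext => n; rewrite seriesEord /=; elim: n => [|n IH]; first by rewrite add0n.
by rewrite addSn big_ord_recr /= IH u0 ?addr0// leq_addl.
Qed.

Lemma expansion_at0 f a : has_expansion f a -> f 0 = a 0%N.
Proof.
have b0 : qball (0 : H) by rewrite /qball /= normr0.
move=> /(_ 0 b0) fa; apply: (cvg_unique _ fa).
  exact: norm_hausdorff.
have := @series_finite (pseries_term a 0) 1; rewrite big_ord1 /pseries_term expr0 mul1r.
by apply=> -[//|n] _; rewrite expr0n mul0r.
Qed.

(** Away from the origin one may divide by [q]; continuity fills in the value
at the origin. *)
Lemma expansion0_shift d :
  has_expansion (fun=> 0) d -> has_expansion (fun=> 0) (fun n => d n.+1).
Proof.
move=> d0; have dz : d 0%N = 0 by rewrite -(expansion_at0 d0).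
have := subexponential_expansion (subexponential_shift (has_expansion_subexponential d0)).
set g := pseries_fun _ => gd.
have g0 q : qball q -> q != 0 -> g q = 0.
  move=> qb qn; apply: (mulrI (_ : q \is a GRing.unit)) => //; rewrite mulr0.
  apply: (cvg_unique _ (cvg_qmull (gd q qb))); first exact: norm_hausdorff.
  have := d0 q qb; rewrite -(cvg_shiftS (series _)); apply: eq_fun_cvg => N /=.
  rewrite !seriesEord /= big_ord_recl /pseries_term dz mulr0 add0r mulr_sumr.
  by apply: eq_bigr => n _; rewrite /bump /= ?add1n mulrA -exprS.
have g00 : g 0 = 0.
  have h01 : 0 < (2^-1 : R) < 1 by lra.
  have [C gC] := expansion_lipschitz gd h01.
  have gt t : 0 < t <= 2^-1 -> `|g 0| <= C * t.
    move=> /andP[t0 t2].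
    have nt : `|t%:A : H| = t by rewrite normrZ qnorm1 mulr1 gtr0_norm.
    have := gC 0 t%:A; rewrite normr0 nt sub0r normrN nt (g0 t%:A).
    - by rewrite subr0; apply => //; lra.
    - by rewrite /qball /= nt; lra.
    - by rewrite -normr_gt0 nt.
  apply/eqP; rewrite -normr_le0 leNgt; apply/negP => gp.
  have gC2 := gt 2^-1 (introT andP (conj _ (lexx _))).
  have C0 : 0 < C by have := gC2 ltac:(lra); lra.
  (* this radius is admissible since `|g 0| <= C / 2 *)
  have : `|g 0| <= C * (`|g 0| / (2 * C)).
    apply: gt; rewrite divr_gt0 ?mulr_gt0//= ler_pdivrMr ?mulr_gt0//.
    by have := gC2 ltac:(lra); lra.
  have -> : C * (`|g 0| / (2 * C)) = `|g 0| / 2 by field; rewrite gt_eqF.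
  lra.
move=> q qb; have := gd q qb; case: (eqVneq q 0) => [->|qn]; first by rewrite g00.
by rewrite g0.
Qed.

Lemma expansion_unique f a b : has_expansion f a -> has_expansion f b -> a = b.
Proof.
move=> fa fb; apply/funext => n; apply/eqP; rewrite -subr_eq0; apply/eqP.
suff : forall d, has_expansion (fun=> 0) d -> d n = 0.
  move=> /(_ (fun n => a n - b n)); apply=> q qb.
  rewrite -[X in _ --> X](subrr (f q)).
  apply: eq_fun_cvg (cvgB (fa q qb) (fb q qb)) => N /=.
  rewrite !fctE !seriesEord /= -sumrB; apply: eq_bigr => k _.
  by rewrite /pseries_term mulrBr.
elim: n => [|n IH] d d0; first by rewrite -(expansion_at0 d0).
by have := IH _ (expansion0_shift d0).
Qed.

Lemma coef_expansion f a : has_expansion f a -> coef f = a.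
Proof.
move=> fa; apply: (@expansion_unique f) => //; rewrite /coef.
by have := @xgetPex _ (fun=> 0) [set a | has_expansion f a]; apply; exists a.
Qed.

Lemma pseries_fun_expansion f a q : has_expansion f a -> qball q -> pseries_fun a q = f q.
Proof. by move=> fa qb; apply: cvg_lim; [exact: norm_hausdorff|exact: fa]. Qed.

End Uniqueness.

(** * Absolutely summable coefficient sequences *)

Section Summable.
Set Implicit Arguments.
Unset Strict Implicit.
Variable R : realType.
Notation H := (quat R).
Implicit Types (f g : H -> H) (a b c : nat -> H) (q : H).

Definition l1 a := exists M : R, forall N, \sum_(n < N) `|a n| <= M.

Definition conv a b : nat -> H := fun n => \sum_(k < n.+1) a k * b (n - k)%N.

(** The Hardy space inner product, read on coefficients. *)
Definition coef_inner a b : H := lim (series (fun n => qconj (b n) * a n) @ \oo).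

Lemma l1_bounded a : l1 a -> exists M : R, forall n, `|a n| <= M.
Proof.
move=> [M aM]; exists M => n; apply: le_trans (aM n.+1).
by rewrite big_ord_recr /= lerDr sumr_ge0.
Qed.

Lemma l1_expansion a : l1 a -> has_expansion (pseries_fun a) a.
Proof.
move=> /l1_bounded [M aM]; apply: subexponential_expansion => r /andP[r0 r1].
exists M => n; rewrite normr_id; apply: le_trans (aM n).
by rewrite ler_piMr// exprn_ile1// ltW.
Qed.

Lemma l1_square_summable a : l1 a -> cvgn (series (fun n => `|a n| ^+ 2)).
Proof.
move=> la; have [M aM] := la; have [B aB] := l1_bounded la.
apply: nondecreasing_is_cvgn.
  by apply/nondecreasing_series => n _ _; exact: sqr_ge0.
exists (B * M) => _ [N _ <-]; rewrite seriesEord /=.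
have B0 : 0 <= B by apply: le_trans (aB 0%N).
apply: le_trans (ler_wpM2l B0 (aM N)); rewrite mulr_sumr; apply: ler_sum => n _.
by rewrite expr2 ler_wpM2r.
Qed.

Lemma l1_coef_inner_cvg a b : l1 a -> l1 b -> cvgn (series (fun n => qconj (b n) * a n)).
Proof.
move=> [M aM] /l1_bounded [B bB]; apply: (@cvgn_bounded_norm_sums _ _ (B * M)) => N.
have B0 : 0 <= B by apply: le_trans (bB 0%N).
apply: le_trans (ler_wpM2l B0 (aM N)); rewrite mulr_sumr; apply: ler_sum => n _.
by rewrite qnormM qnorm_conj ler_wpM2r.
Qed.

Lemma l1_scale (s : R) a : l1 a -> l1 (fun n => s *: a n).
Proof.
move=> [M aM]; exists (`|s| * M) => N; apply: le_trans (ler_wpM2l (normr_ge0 _) (aM N)).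
by rewrite mulr_sumr; apply: ler_sum => n _; rewrite normrZ.
Qed.

Lemma l1_finite a N : (forall n, (N <= n)%N -> a n = 0) -> l1 a.
Proof.
move=> a0; exists (\sum_(n < N) `|a n|) => m.
have aux k : \sum_(n < N + k) `|a n| = \sum_(n < N) `|a n|.
  elim: k => [|k IH]; first by rewrite addn0.
  by rewrite addnS big_ord_recr /= IH a0 ?leq_addr// normr0 addr0.
rewrite -(aux m) addnC big_split_ord /= lerDl.
by apply: sumr_ge0.
Qed.

(** Grouping the triangle [k <= n < N] by [k]: for nonnegative terms, extending
the inner sum then bounds the partial sums of a convolution by products of
partial sums. *)
Lemma sum_conv_real (u v : nat -> R) N :
  \sum_(n < N) \sum_(k < n.+1) u k * v (n - k)%N =
  \sum_(k < N) u k * \sum_(j < N - k) v j.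
Proof.
elim: N => [|N IH]; first by rewrite !big_ord0.
rewrite big_ord_recr /= {}IH [RHS]big_ord_recr /= subSnn big_ord1.
rewrite [X in _ + X]big_ord_recr /= subnn addrA; congr (_ + _).
rewrite -big_split /=; apply: eq_bigr => k _.
by rewrite subSn ?big_ord_recr /= ?mulrDr// ltnW.
Qed.

Lemma l1_conv a b : l1 a -> l1 b -> l1 (conv a b).
Proof.
move=> [M aM] [B bB]; exists (M * B) => N.
have B0 : 0 <= B by apply: le_trans (bB 0%N); rewrite big_ord0.
apply: le_trans (ler_wpM2r B0 (aM N)).
apply: (@le_trans _ _ (\sum_(n < N) \sum_(k < n.+1) `|a k| * `|b (n - k)%N|)).
  apply: ler_sum => n _; apply: le_trans (ler_norm_sum _ _ _) _.
  by apply: ler_sum => k _; rewrite qnormM.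
rewrite (sum_conv_real (fun n => `|a n|) (fun n => `|b n|)) mulr_suml.
by apply: ler_sum => k _; apply: ler_wpM2l.
Qed.

(** Coefficients up to order [n] of a convolution only see truncations, which
are polynomials; associativity is that of the polynomial ring. *)
Lemma convA a b c : conv (conv a b) c = conv a (conv b c).
Proof.
apply/funext => n.
pose P (d : nat -> H) := \poly_(i < n.+1) d i.
have PM d e k : (k <= n)%N -> (P d * P e)`_k = conv d e k.
  move=> kn; rewrite coefM; apply: eq_bigr => i _.
  have ik : (i <= k)%N by rewrite -ltnS.
  by rewrite !coef_poly !ltnS (leq_trans ik kn) (leq_trans (leq_subr _ _) kn).
have := congr1 (fun p : {poly H} => p`_n) (mulrA (P a) (P b) (P c)).
rewrite !coefM => eqn; rewrite [LHS]/conv [RHS]/conv.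
transitivity (\sum_(j < n.+1) (P a * P b)`_j * (P c)`_(n - j)).
  apply: eq_bigr => j _; rewrite PM -1?ltnS// coef_poly ltnS leq_subr//.
rewrite -eqn; apply: eq_bigr => j _.
by rewrite PM ?leq_subr// coef_poly ltn_ord.
Qed.

Lemma conv_comm a b : (forall i j, GRing.comm (a i) (b j)) -> conv a b = conv b a.
Proof.
move=> ab; apply/funext => n; rewrite /conv (reindex_inj rev_ord_inj) /=.
apply: eq_bigr => k _; rewrite subSS subKn ?ab//.
by rewrite -ltnS.
Qed.

Lemma conv1 a : conv (fun n => (n == 0%N)%:R) a = a.
Proof.
apply/funext => n; rewrite /conv big_ord_recl /= mul1r subn0 big1 ?addr0// => k _.
by rewrite mul0r.
Qed.

Lemma convZr (s : R) a b : conv a (fun n => s *: b n) = (fun n => s *: conv a b n).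
Proof.
by apply/funext => n; rewrite /conv scaler_sumr; apply: eq_bigr => k _; rewrite -scalerAr.
Qed.

Lemma coef_innerZ (s t : R) a b : l1 a -> l1 b ->
  coef_inner (fun n => s *: a n) (fun n => t *: b n) = (s * t) *: coef_inner a b.
Proof.
move=> la lb; apply: cvg_lim; first exact: norm_hausdorff.
have -> : series (fun n => qconj (t *: b n) * (s *: a n)) =
    (s * t) \*: series (fun n => qconj (b n) * a n).
  apply/funext => N /=; rewrite !seriesEord /= scaler_sumr; apply: eq_bigr => n _.
  by rewrite qconjZ -scalerAr -scalerAl scalerA.
by apply: cvgZl_tmp; exact: l1_coef_inner_cvg.
Qed.

Lemma coef_inner_conj a b : l1 a -> l1 b -> coef_inner a b = qconj (coef_inner b a).
Proof.
move=> la lb; apply: cvg_lim; first exact: norm_hausdorff.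
apply: eq_fun_cvg (cvg_qconj (l1_coef_inner_cvg lb la)) => N /=.
rewrite !seriesEord /= qconj_sum; apply: eq_bigr => n _.
by rewrite qconjM qconjK.
Qed.

Lemma star_expansion f g a b : has_expansion f a -> has_expansion g b ->
  l1 a -> l1 b -> has_expansion (star f g) (conv a b).
Proof.
move=> fa gb la lb; rewrite /star (coef_expansion fa) (coef_expansion gb).
exact: l1_expansion (l1_conv la lb).
Qed.

End Summable.

(** * The Cauchy kernel *)

Section Kernel.
Set Implicit Arguments.
Unset Strict Implicit.
Variable R : realType.
Notation H := (quat R).
Implicit Types (f g : H -> H) (a b c q u v w : H) (x y h : nat -> H).

Definition linear_coef u v : nat -> H :=
  fun n => match n with 0%N => u | 1%N => v | _ => 0 end.

Lemma l1_linear_coef u v : l1 (linear_coef u v).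
Proof. by apply: (@l1_finite _ _ 2) => -[|[|n]]. Qed.

Lemma linear_expansion u v : has_expansion (fun q => u + q * v) (linear_coef u v).
Proof.
move=> q _; have := @series_finite R (pseries_term (linear_coef u v) q) 2.
rewrite big_ord_recl big_ord1 /pseries_term /= expr0 expr1 mul1r; apply.
by move=> -[|[|n]]// _; rewrite mulr0.
Qed.

Lemma conv_linear0 u v x : conv (linear_coef u v) x 0%N = u * x 0%N.
Proof. by rewrite /conv big_ord1. Qed.

Lemma conv_linearS u v x n :
  conv (linear_coef u v) x n.+1 = u * x n.+1 + v * x n.
Proof.
rewrite /conv !big_ord_recl /= subn0 subSS subn0 big1 ?addr0// => k _.
by rewrite mul0r.
Qed.

Definition kernel_coef c : nat -> H := fun n => qconj c ^+ n.

Lemma l1_kernel_coef c : `|c| < 1 -> l1 (kernel_coef c).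
Proof.
move=> c1; exists ((1 - `|c|)^-1) => N.
have c01 : 0 <= `|c| < 1 by rewrite normr_ge0.
apply: le_trans (geometric_sum_le N c01); apply: ler_sum => n _.
by rewrite qnormX qnorm_conj.
Qed.

Lemma conv_kernel0 c x : conv (kernel_coef c) x 0%N = x 0%N.
Proof. by rewrite /conv big_ord1 mul1r. Qed.

Lemma conv_kernelS c x n : conv (kernel_coef c) x n.+1 =
  x n.+1 + qconj c * conv (kernel_coef c) x n.
Proof.
rewrite /conv big_ord_recl /= /kernel_coef expr0 mul1r subn0; congr (_ + _).
rewrite mulr_sumr; apply: eq_bigr => k _.
by rewrite /bump /= add1n subSS exprS mulrA.
Qed.

(** Each term [q ^+ n * qconj c ^+ n] after the first is the previous one
multiplied by [q] on the left and by [qconj c] on the right. This two-sided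
equation takes the place of a closed form, as [q] and [c] need not commute. *)
Lemma kernel_sum_fixpoint c q : `|c| < 1 -> qball q ->
  pseries_fun (kernel_coef c) q = 1 + q * pseries_fun (kernel_coef c) q * qconj c.
Proof.
move=> c1 qb; have kq := l1_expansion (l1_kernel_coef c1) qb.
have ks := kq; rewrite -(cvg_shiftS (series _)) in ks.
apply: (cvg_unique _ ks); first exact: norm_hausdorff.
have ql : (fun N => 1 + q * series (pseries_term (kernel_coef c) q) N * qconj c) @ \oo -->
    1 + q * pseries_fun (kernel_coef c) q * qconj c.
  by apply: cvgD; [exact: cvg_cst | apply: cvg_qmulr; exact: cvg_qmull].
apply: eq_fun_cvg ql => N /=.
rewrite !seriesEord /= [RHS]big_ord_recl /pseries_term /kernel_coef /= !expr0 mulr1.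
congr (_ + _); rewrite mulr_sumr mulr_suml; apply: eq_bigr => k _.
by rewrite /bump /= ?add1n exprS exprSr !mulrA.
Qed.

(** With [f = 1 - q * qconj c], the symmetrization of [f] has real
coefficients, so it commutes past the geometric sum [s] and
[symm f q * s = 1 - q * c = rconj f q]. The same identity shows that
[symm f q] is invertible: [1 - q * c] does not vanish, as [|q| * |c| < 1]. *)
Lemma cauchy_kernel_expansion c :
  `|c| < 1 -> has_expansion (cauchy_kernel c) (kernel_coef c).
Proof.
move=> c1 q qb.
pose f : H -> H := fun q => 1 - q * qconj c.
have fE : has_expansion f (linear_coef 1 (- qconj c)).
  have := @linear_expansion 1 (- qconj c).
  by under eq_fun do rewrite mulrN.
have lc : (fun n => qconj (coef f n)) = linear_coef 1 (- c).
  apply/funext => n; rewrite (coef_expansion fE).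
  by case: n => [|[|n]] /=; apply: quat_ext => /=; ring.
have fcE : has_expansion (rconj f) (linear_coef 1 (- c)).
  by rewrite /rconj lc; exact: l1_expansion (l1_linear_coef _ _).
have rq : rconj f q = 1 - q * c.
  have lq := @linear_expansion 1 (- c) q qb; rewrite mulrN in lq.
  exact: (cvg_unique (@norm_hausdorff _ _) (fcE q qb) lq).
have sq : symm f q = 1 - q * (qconj c + c) + q ^+ 2 * (qconj c * c).
  have sE := star_expansion fE fcE (l1_linear_coef _ _) (l1_linear_coef _ _).
  apply: (cvg_unique (@norm_hausdorff _ _) (sE q qb)).
  set d := conv _ _.
  have := @series_finite R (pseries_term d q) 3.
  rewrite !big_ord_recl big_ord0 /pseries_term /bump /= /d conv_linear0 !conv_linearS /=.
  rewrite expr0 expr1 !mul1r !mulr1 !add0r mulrNN addr0 addrA.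
  rewrite -opprD mulrN [c + _]addrC; apply.
  by move=> -[|[|[|n]]]// _; rewrite conv_linearS /= !mulr0 addr0 mulr0.
set s := pseries_fun (kernel_coef c) q.
have sfix : s - q * s * qconj c = 1.
  by rewrite {1}/s kernel_sum_fixpoint// addrK.
have ss : symm f q * s = 1 - q * c.
  have tr : (qconj c + c) * s = s * (qconj c + c) by apply: quat_ext => /=; ring.
  have nm : (qconj c * c) * s = s * (qconj c * c) by apply: quat_ext => /=; ring.
  have e1 : q * (qconj c + c) * s = q * s * qconj c + q * s * c.
    by rewrite -mulrA tr !mulrDr !mulrA.
  have e2 : q ^+ 2 * (qconj c * c) * s = q * (q * s * qconj c) * c.
    by rewrite -mulrA nm expr2 !mulrA.
  transitivity (s - q * s * qconj c - q * (s - q * s * qconj c) * c).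
    2: by rewrite sfix mulr1.
  rewrite sq mulrDl mulrBl mul1r e1 e2 [q * (s - _)]mulrBr mulrBl.
  by rewrite opprB opprD !addrA; exact: addrAC.
have qc : 1 - q * c != 0.
  rewrite subr_eq0; apply/eqP => qc1.
  have : `|q| * `|c| = 1 by rewrite -qnormM -qc1 qnorm1.
  move: qb; rewrite /qball /= => qb.
  have := normr_ge0 q; have := normr_ge0 c; nra.
have s0 : symm f q != 0 by apply: contraNneq qc => s0; rewrite -ss s0 mul0r.
suff -> : cauchy_kernel c q = s by exact: l1_expansion (l1_kernel_coef c1) q qb.
by rewrite /cauchy_kernel /rinv -/f rq -ss mulKr.
Qed.

End Kernel.

(** * Blaschke functions and the Malmquist-Takenaka system *)

Section Blaschke.
Set Implicit Arguments.
Unset Strict Implicit.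
Variable R : realType.
Notation H := (quat R).
Implicit Types (c q : H) (x y f g : nat -> H) (a : nat -> H).

Definition blaschke_coef c : nat -> H := conv (kernel_coef c) (linear_coef (- c) 1).

Lemma l1_blaschke_coef c : `|c| < 1 -> l1 (blaschke_coef c).
Proof. by move=> c1; apply: l1_conv; [exact: l1_kernel_coef|exact: l1_linear_coef]. Qed.

Lemma blaschke_expansion c : `|c| < 1 -> has_expansion (blaschke c) (blaschke_coef c).
Proof.
move=> c1; apply: star_expansion.
- exact: cauchy_kernel_expansion.
- have := @linear_expansion R (- c) 1.
  by under eq_fun do rewrite mulr1 addrC.
- exact: l1_kernel_coef.
- exact: l1_linear_coef.
Qed.

(** The coefficients of the kernel at [c] and of [q - c] are polynomials in [c]
and [qconj c], hence commute, and the factors of [B_c] can be swapped. *)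
Lemma conv_blaschke c x :
  conv (blaschke_coef c) x = conv (linear_coef (- c) 1) (conv (kernel_coef c) x).
Proof.
rewrite /blaschke_coef (conv_comm (a := kernel_coef c)) ?convA// => i j; apply/commr_sym.
rewrite /kernel_coef; apply: commrX; case: j => [|[|j]] /=.
- by rewrite /GRing.comm; apply: quat_ext => /=; ring.
- exact/commr_sym/commr1.
- exact/commr_sym/commr0.
Qed.

Lemma conv_blaschke0 c x : conv (blaschke_coef c) x 0%N = - c * x 0%N.
Proof. by rewrite conv_blaschke conv_linear0 conv_kernel0. Qed.

Lemma conv_blaschkeS c x n : let g := conv (kernel_coef c) x in
  conv (blaschke_coef c) x n.+1 = g n - c * g n.+1.
Proof. by rewrite conv_blaschke conv_linearS mul1r mulNr addrC. Qed.

Lemma l1_cvg0 x : l1 x -> x @ \oo --> 0.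
Proof. by move=> [M xM]; apply: cvg_series_cvg_0; exact: cvgn_bounded_norm_sums xM. Qed.

(** The cross terms cancel, because [qconj (c * k1) * g0] equals
[qconj k1 * (qconj c * g0)]. *)
Lemma blaschke_term_diff c (g0 g1 k0 k1 : H) :
  qconj (k0 - c * k1) * (g0 - c * g1) - qconj (k1 - qconj c * k0) * (g1 - qconj c * g0) =
  (1 - `|c| ^+ 2) *: (qconj k0 * g0 - qconj k1 * g1).
Proof. by rewrite -qnormsqE /qnormsq; apply: quat_ext => /=; ring. Qed.

(** With [g] and [k] the products of the kernel with [x] and [y], one has
[x n.+1 = g n.+1 - qconj c * g n], to be compared with the entry
[g n - c * g n.+1] of the Blaschke product; [blaschke_term_diff] then makes
the sum of differences telescope. *)
Lemma blaschke_partial_sums c x y N :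
  let g := conv (kernel_coef c) x in let k := conv (kernel_coef c) y in
  series (fun n => qconj (conv (blaschke_coef c) y n) * conv (blaschke_coef c) x n) N.+1 =
  series (fun n => qconj (y n) * x n) N.+1 - (1 - `|c| ^+ 2) *: (qconj (k N) * g N).
Proof.
move=> g k; rewrite !seriesEord /=; elim: N => [|N IH].
  rewrite !big_ord1 !conv_blaschke0 /g /k !conv_kernel0 -qnormsqE /qnormsq.
  by apply: quat_ext => /=; ring.
rewrite big_ord_recr /= IH [in RHS]big_ord_recr /= !conv_blaschkeS -/g -/k.
have xE : x N.+1 = g N.+1 - qconj c * g N by rewrite /g conv_kernelS addrK.
have yE : y N.+1 = k N.+1 - qconj c * k N by rewrite /k conv_kernelS addrK.
have := blaschke_term_diff c (g N) (g N.+1) (k N) (k N.+1).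
rewrite -xE -yE => /eqP; rewrite subr_eq scalerBr => /eqP ->.
by rewrite !addrA subrK addrAC.
Qed.

Lemma coef_inner_blaschke c x y : `|c| < 1 -> l1 x -> l1 y ->
  coef_inner (conv (blaschke_coef c) x) (conv (blaschke_coef c) y) = coef_inner x y.
Proof.
move=> c1 lx ly; apply: cvg_lim; first exact: norm_hausdorff.
rewrite -cvg_shiftS.
set g := conv (kernel_coef c) x; set k := conv (kernel_coef c) y.
have lg : l1 g by apply: l1_conv => //; exact: l1_kernel_coef.
have lk : l1 k by apply: l1_conv => //; exact: l1_kernel_coef.
have kg0 : (fun n => qconj (k n) * g n) @ \oo --> 0.
  exact: cvg_series_cvg_0 (l1_coef_inner_cvg lg lk).
have xy : (fun N => series (fun n => qconj (y n) * x n) N.+1) @ \oo --> coef_inner x y.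
  rewrite (cvg_shiftS (series (fun n => qconj (y n) * x n))); exact: l1_coef_inner_cvg.
have lim : (fun N => series (fun n => qconj (y n) * x n) N.+1 -
    (1 - `|c| ^+ 2) *: (qconj (k N) * g N)) @ \oo --> coef_inner x y.
  rewrite -[X in _ --> X]subr0 -[X in _ --> _ - X](scaler0 _ (1 - `|c| ^+ 2)).
  by apply: cvgB xy _; exact: cvgZl_tmp.
by apply: eq_fun_cvg lim => N; rewrite -blaschke_partial_sums.
Qed.

(** Pairing with the kernel evaluates at [c], where [B_c] vanishes: the sum of
[c ^+ n * (g n.-1 - c * g n)] telescopes. *)
Lemma coef_inner_blaschke_kernel c x : `|c| < 1 -> l1 x ->
  coef_inner (conv (blaschke_coef c) x) (kernel_coef c) = 0.
Proof.
move=> c1 lx; apply: cvg_lim; first exact: norm_hausdorff.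
rewrite -cvg_shiftS.
set g := conv (kernel_coef c) x.
have /l1_cvg0 g0 : l1 g by apply: l1_conv => //; exact: l1_kernel_coef.
have E N : series (fun n => qconj (kernel_coef c n) * conv (blaschke_coef c) x n) N.+1 =
    - (c ^+ N.+1 * g N).
  rewrite seriesEord /=; elim: N => [|N IH].
    by rewrite big_ord1 conv_blaschke0 /g conv_kernel0 qconjX qconjK mul1r expr1 mulNr.
  rewrite big_ord_recr /= IH conv_blaschkeS -/g qconjX qconjK mulrBr.
  by rewrite addrA addNr sub0r mulrA -exprSr.
apply: (@cvg_norm_dominated _ _ \oo _ _ _ (fun N => `|g N|) 1).
  near=> N; rewrite /= E subr0 normrN qnormM qnormX mul1r ler_piMl//.
  by rewrite exprn_ile1// ltW.
by rewrite -[X in _ --> X](@normr0 _ H); exact: cvg_norm.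
Unshelve. all: by end_near. Qed.

Lemma coef_inner_kernel c : `|c| < 1 ->
  (1 - `|c| ^+ 2) *: coef_inner (kernel_coef c) (kernel_coef c) = 1.
Proof.
move=> c1.
have c2 : `| (`|c| ^+ 2) | < 1 by rewrite ger0_norm ?sqr_ge0// expr_lt1.
have c2' : 1 - `|c| ^+ 2 != 0.
  by rewrite subr_eq0 eq_sym lt_eqF// -[X in X < _]ger0_norm// sqr_ge0.
suff -> : coef_inner (kernel_coef c) (kernel_coef c) = (1 / (1 - `|c| ^+ 2)) *: 1.
  by rewrite scalerA mulrC divfK// scale1r.
apply: cvg_lim; first exact: norm_hausdorff.
have lim : (fun N => series (geometric 1 (`|c| ^+ 2)) N *: (1 : H)) @ \oo -->
    (1 / (1 - `|c| ^+ 2)) *: (1 : H).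
  by apply: cvgZr_tmp; exact: cvg_geometric_series.
apply: eq_fun_cvg lim => N /=; rewrite !seriesEord /= scaler_suml; apply: eq_bigr => n _.
rewrite /geometric /= mul1r -exprM mulnC exprM -qnormX /kernel_coef.
by rewrite -qconjX qconjK mulr_qconj.
Qed.

Lemma expansion_scale (s : R) (F : H -> H) x :
  has_expansion F x -> has_expansion (fun q => s *: F q) (fun n => s *: x n).
Proof.
move=> Fx q qb; have sF : (fun N => s *: series (pseries_term x q) N) @ \oo --> s *: F q.
  by apply: cvgZl_tmp; exact: Fx.
apply: eq_fun_cvg sF => N; rewrite !seriesEord /= scaler_sumr; apply: eq_bigr => n _.
by rewrite /pseries_term scalerAr.
Qed.

(** Starting from the empty product, unlike [blaschke_prod], makes the first
member of the system a case like the others: [blaschke_prod a k] has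
coefficients [blaschke_prod_coef a k.+1]. *)
Fixpoint blaschke_prod_coef a k : nat -> H :=
  if k is k'.+1 then conv (blaschke_prod_coef a k') (blaschke_coef (a k))
  else fun n => (n == 0%N)%:R.

Section Sequence.
Variable a : nat -> H.
Hypothesis a1 : forall n, (1 <= n)%N -> `|a n| < 1.

Lemma l1_blaschke_prod_coef k : l1 (blaschke_prod_coef a k).
Proof.
elim: k => [|k IH]; last by apply: l1_conv => //; apply: l1_blaschke_coef; exact: a1.
by apply: (@l1_finite _ _ 1) => -[].
Qed.

Lemma blaschke_prod_expansion k :
  has_expansion (blaschke_prod a k) (blaschke_prod_coef a k.+1).
Proof.
elim: k => [|k IH]; first by rewrite /= conv1; apply: blaschke_expansion; exact: a1.
apply: star_expansion => //.
- by apply: blaschke_expansion; exact: a1.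
- exact: (l1_blaschke_prod_coef k.+1).
- by apply: l1_blaschke_coef; exact: a1.
Qed.

Lemma coef_inner_blaschke_prod k x y : l1 x -> l1 y ->
  coef_inner (conv (blaschke_prod_coef a k) x) (conv (blaschke_prod_coef a k) y) =
  coef_inner x y.
Proof.
elim: k x y => [|k IH] x y lx ly; first by rewrite !conv1.
have c1 : `|a k.+1| < 1 by exact: a1.
have lB z : l1 z -> l1 (conv (blaschke_coef (a k.+1)) z).
  by apply: l1_conv; exact: l1_blaschke_coef.
rewrite /= !(convA (blaschke_prod_coef a k)) (IH _ _ (lB x lx) (lB y ly)).
exact: coef_inner_blaschke.
Qed.

Lemma blaschke_prod_coef_split l k : (l < k)%N -> exists2 Q, l1 Q &
  blaschke_prod_coef a k =
  conv (blaschke_prod_coef a l) (conv (blaschke_coef (a l.+1)) Q).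
Proof.
elim: k => // k IH; rewrite ltnS leq_eqVlt => /orP[/eqP ->|/IH [Q lQ QE]].
  exists (fun n => (n == 0%N)%:R); first exact: (l1_blaschke_prod_coef 0).
  rewrite (conv_comm (a := blaschke_coef _)) ?conv1//.
  by move=> i j; case: (j == 0%N); [exact: commr1|exact: commr0].
exists (conv Q (blaschke_coef (a k.+1))); last first.
  by rewrite /= QE (convA (blaschke_prod_coef a l)) (convA _ Q).
by apply: l1_conv => //; apply: l1_blaschke_coef; exact: a1.
Qed.

Definition malmquist_coef k : nat -> H := fun n =>
  Num.sqrt (1 - `|a k.+1| ^+ 2) *:
    conv (blaschke_prod_coef a k) (kernel_coef (a k.+1)) n.

Lemma l1_malmquist_coef k : l1 (malmquist_coef k).
Proof.
apply: l1_scale; apply: l1_conv; first exact: l1_blaschke_prod_coef.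
by apply: l1_kernel_coef; exact: a1.
Qed.

Lemma malmquist_expansion k : has_expansion (malmquist a k.+1) (malmquist_coef k).
Proof.
case: k => [|k]; apply: expansion_scale.
  by rewrite conv1; apply: cauchy_kernel_expansion; exact: a1.
apply: star_expansion.
- exact: blaschke_prod_expansion.
- by apply: cauchy_kernel_expansion; exact: a1.
- exact: (l1_blaschke_prod_coef k.+1).
- by apply: l1_kernel_coef; exact: a1.
Qed.

Lemma coef_inner_malmquist_eq k : coef_inner (malmquist_coef k) (malmquist_coef k) = 1.
Proof.
have c1 : `|a k.+1| < 1 by exact: a1.
have lK := l1_kernel_coef c1.
have lB := l1_conv (l1_blaschke_prod_coef k) lK.
rewrite coef_innerZ// coef_inner_blaschke_prod// -expr2 sqr_sqrtr ?coef_inner_kernel//.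
by rewrite subr_ge0 exprn_ile1// ltW.
Qed.

Lemma coef_inner_malmquist_lt l k :
  (l < k)%N -> coef_inner (malmquist_coef k) (malmquist_coef l) = 0.
Proof.
move=> lk.
have l1K m : l1 (kernel_coef (a m.+1)) by apply: l1_kernel_coef; exact: a1.
have l1B m := l1_conv (l1_blaschke_prod_coef m) (l1K m).
rewrite coef_innerZ//; have [Q lQ ->] := blaschke_prod_coef_split lk.
have lQK := l1_conv lQ (l1K k).
have c1 : `|a l.+1| < 1 by exact: a1.
rewrite (convA (blaschke_prod_coef a l)) (convA _ Q).
rewrite coef_inner_blaschke_prod//; last exact: l1_conv (l1_blaschke_coef c1) lQK.
by rewrite coef_inner_blaschke_kernel// scaler0.
Qed.

End Sequence.

End Blaschke.

Theorem theorem4p1 (R : realType) (a : nat -> quat R)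
    (a_lt1 : forall n, (1 <= n)%N -> `|a n| < 1)
    (a_slice : exists2 I : quat R, imag_unit I &
       forall n, (1 <= n)%N ->
         exists theta : R, a n = `|a n| *: ((cos theta)%:A + sin theta *: I)) :
  (forall n, (1 <= n)%N ->
     slice_regular (malmquist a n) /\ hardy2 (malmquist a n)) /\
  (forall n m, (1 <= n)%N -> (1 <= m)%N ->
     hardy_inner (malmquist a n) (malmquist a m) = (n == m)%:R).
Proof.
split=> [[//|n] _|[//|n] [//|m] _ _].
  have nE := @malmquist_expansion R a a_lt1 n.
  have reg := expansion_slice_regular nE.
  split=> //; split=> //; exists (malmquist_coef a n) => //.
  exact/l1_square_summable/l1_malmquist_coef.
rewrite /hardy_inner !(coef_expansion (@malmquist_expansion R a a_lt1 _)) eqSS.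
rewrite -/(coef_inner (malmquist_coef a n) (malmquist_coef a m)).
case: (ltngtP n m) => [nm|mn|->].
- rewrite coef_inner_conj; last 2 first.
  + exact: l1_malmquist_coef.
  + exact: l1_malmquist_coef.
  by rewrite coef_inner_malmquist_lt// qconj0.
- exact: coef_inner_malmquist_lt.
- exact: coef_inner_malmquist_eq.
Qed.
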